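(* Fix integers $n\ge 3$ and $r\ge 1$. Every nonzero complex root $\lambda$ of $\Phi_{n,r}$ satisfies $$\mathrm{Im}(\lambda^n)=0,\qquad 0<\mathrm{Re}(\lambda^n)<\frac{27}{4}.$$
   Context: For integers $n\ge3$ and $r\ge1$, the digraph $\Gamma_{n,r}$ has vertex set $V(\Gamma_{n,r})=\{1,2,\dots,rn-2r+2\}$ and directed edge set $E(\Gamma_{n,r})$ defined by $E(\Gamma_{n,1})=\{(j,j+1):1\le j\le n-1\}\cup\{(n,1)\}$; $E(\Gamma_{n,2})=E(\Gamma_{n,1})\cup\{(1,n+1)\}\cup\{(j,j+1):n+1\le j\le 2n-3\}\cup\{(2n-2,n)\}$; and for $r\ge3$, $E(\Gamma_{n,r})=E(\Gamma_{n,2})\cup\bigcup_{i=1}^{r-2}F_i$, where $F_i=\{(in-2i+2,\,in+n-2i+1)\}\cup\{(j,j+1):in+n-2i+1\le j\le in+2n-2i-3\}\cup\{(in+2n-2i-2,\,in+n-2i)\}$. (For $n=3$ the middle path parts are empty.) The adjacency matrix $A_{n,r}$ is the $(0,1)$-matrix indexed by $V(\Gamma_{n,r})$ whose $(u,v)$-entry is $1$ if and only if $(u,v)\in E(\Gamma_{n,r})$, and $\Phi_{n,r}(x)=\det(xI-A_{n,r})\in\mathbb Z[x]$. *)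

(* Defs.v *)
From HB Require Import structures.
From mathcomp Require Import all_boot all_order all_algebra.
From mathcomp Require Import complex.
From mathcomp Require Import reals.

Set Implicit Arguments.
Unset Strict Implicit.
Unset Printing Implicit Defensive.

Import Order.TTheory GRing.Theory Num.Theory.

(* Vertices are numbered from 1, and edge relations are given on nat.  All
   subtractions below are truncated; they are exact when 3 <= n, 1 <= r and
   1 <= i. *)

Definition nb_vertices (n r : nat) : nat := r * n - 2 * r + 2.

(* The edges (j, j + 1) for lo <= j <= hi. *)
Definition path_edges (lo hi : nat) : rel nat :=
  fun u v => (lo <= u <= hi) && (v == u.+1).

Definition single_edge (a b : nat) : rel nat :=
  fun u v => (u == a) && (v == b).

Definition edges1 (n : nat) : rel nat := fun u v =>
  path_edges 1 (n - 1) u v || single_edge n 1 u v.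

Definition edges2 (n : nat) : rel nat := fun u v =>
  [|| edges1 n u v,
      single_edge 1 (n + 1) u v,
      path_edges (n + 1) (2 * n - 3) u v
    | single_edge (2 * n - 2) n u v].

Definition edgesF (n i : nat) : rel nat := fun u v =>
  [|| single_edge (i * n - 2 * i + 2) (i * n + n - 2 * i + 1) u v,
      path_edges (i * n + n - 2 * i + 1) (i * n + 2 * n - 2 * i - 3) u v
    | single_edge (i * n + 2 * n - 2 * i - 2) (i * n + n - 2 * i) u v].

(* The case r = 0 is irrelevant; for r = 2 the range 1 <= i <= r - 2 of the
   union is empty. *)
Definition edges (n r : nat) : rel nat := fun u v =>
  if r <= 1 then edges1 n u v
  else edges2 n u v || has (fun i => edgesF n i u v) (iota 1 (r - 2)).

Local Open Scope ring_scope.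

(* The ordinals u, v : 'I_(nb_vertices n r) index the vertices u + 1, v + 1. *)
Definition adjacency (n r : nat) : 'M[int]_(nb_vertices n r) :=
  \matrix_(u, v) (edges n r u.+1 v.+1)%:R.

Definition Phi (n r : nat) : {poly int} := char_poly (adjacency n r).

(* Main.v *)
Require Import Defs.
From mathcomp Require Import all_boot all_order all_algebra.
From mathcomp Require Import complex.
From mathcomp Require Import reals.
From mathcomp Require Import ring lra zify.

(** The digraph is a chain of [r] directed n-cycles in which consecutive cycles
    share an edge.  The shared edges line up into a path descending through
    certain vertices, the hubs [t_0 = 2], [t_1 = 1] and
    [t_(k+2) = n + k (n - 2)]: from [t_(k+1)] one can either step down to [t_k]
    or climb, through [n - 2] edges, to [t_(k+3)].  Every other vertex has just
    one successor.

    Let [V] be an eigenvector for a nonzero eigenvalue [l].  The vertices with a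
    single successor only multiply by [l], so that [V] is determined by its
    values on the hubs, and the rescaled values [a_k = l^k V(t_k)] satisfy
    [a_k = a_(k+1) - y a_(k+3)] with [y = l^-n], where [a_k = 0] beyond the
    last hub [t_(r+1)].  Read downwards from there, this is the recurrence
    [p_(j+3) = p_(j+2) - y p_j], [p_0 = p_1 = p_2 = 1], of [trinom_seq], and the
    equation at the vertex [t_0] closes it with [p_(r+2)(y) = 0]
    ([Phi_root_trinom_seq]).

    It remains to see that a root [y] of any [p_j] is real and larger than
    [4/27] ([trinom_seq_root_real]).  If [y] is in the open upper half plane,
    let [K] be the convex cone spanned by [1] and [-y]; if [w] is in [K] and
    nonzero then [-y/w] is in [K] as well.  Hence, inductively, the ratios
    [p_(j+1)/p_j] and [p_(j+2)/p_j] stay in [K] and never vanish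
    ([in_cone_step]).  Conjugation handles the lower half plane.  If [y] is real
    and at most [4/27], the ratios [p_(j+1)/p_j] stay at least [2/3], which is
    the double root of [t^3 - t^2 + 4/27] ([trinom_seq_real_gt0]). *)

Set Implicit Arguments.
Unset Strict Implicit.
Unset Printing Implicit Defensive.
Import Order.TTheory GRing.Theory Num.Theory.
Local Open Scope ring_scope.

(** * Roots of the sequence p_(j+3) = p_(j+2) - y p_j *)

Fixpoint trinom_seq (A : pzRingType) (y : A) (j : nat) : A :=
  if j is ((j0.+1).+1 as j2).+1 then trinom_seq y j2 - y * trinom_seq y j0
  else 1.

Lemma trinom_seqS (A : pzRingType) (y : A) j :
  trinom_seq y j.+3 = trinom_seq y j.+2 - y * trinom_seq y j.
Proof. by []. Qed.

Lemma nat_ind3 (P : nat -> Prop) : P 0 -> P 1 -> P 2 ->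
  (forall j, P j -> P j.+1 -> P j.+2 -> P j.+3) -> forall j, P j.
Proof.
move=> P0 P1 P2 PS j; suff [] : [/\ P j, P j.+1 & P j.+2] by [].
by elim: j => [//|j [? ? ?]]; split=> //; apply: PS.
Qed.

Lemma trinom_seq_rmorph (A B : pzRingType) (f : {rmorphism A -> B}) y j :
  trinom_seq (f y) j = f (trinom_seq y j).
Proof.
elim/nat_ind3: j => [|||j IH0 _ IH2]; rewrite ?rmorph1 //.
by rewrite !trinom_seqS rmorphB rmorphM IH0 IH2.
Qed.

(** The ratio [p_(j+1)/p_j] stays at least [2/3]: if two consecutive ratios are,
    the next one is at least [1 - (4/27)(3/2)^2 = 2/3]. *)
Lemma trinom_seq_real_gt0 (R : realFieldType) (y : R) j :
  y <= 4%:R / 27%:R -> 0 < trinom_seq y j.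
Proof.
move=> hy; suff [] : [/\ 0 < trinom_seq y j,
     2%:R * trinom_seq y j <= 3%:R * trinom_seq y j.+1
   & 2%:R * trinom_seq y j.+1 <= 3%:R * trinom_seq y j.+2] by [].
elim: j => [|j []]; first by split=> /=; lra.
rewrite trinom_seqS.
move: (trinom_seq y j) (trinom_seq y j.+1) (trinom_seq y j.+2) => a b c.
move=> a0 ab bc; split=> //; first by lra.
have : y * a <= 4%:R / 27%:R * a by rewrite ler_pM2r.
lra.
Qed.

Section Cone.
Variable R : rcfType.
Implicit Types y u v : R[i].

(** For [y] in the upper half plane and [u != 0], this says that [v / u] is in
    the convex cone spanned by [1] and [-y].  It is phrased with cross products
    so that the induction below never has to divide. *)
Definition in_cone y u v : Prop :=
  complex.Im (v * conjc u) <= 0 /\ complex.Im (v * conjc (y * u)) <= 0.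

(** Each cross product with the new term [p2 - y p0] is one with [p2] minus one
    with [y p0], whose signs are known from the hypotheses.  The cross product
    with [y p2] even contains the strictly negative [- |p2|^2 Im y], so the new
    term does not vanish. *)
Lemma in_cone_step y p0 p1 p2 : 0 < complex.Im y -> p2 != 0 ->
  in_cone y p0 p1 -> in_cone y p1 p2 -> in_cone y p0 p2 ->
  [/\ p2 - y * p0 != 0, in_cone y p2 (p2 - y * p0)
    & in_cone y p1 (p2 - y * p0)].
Proof.
move=> y_gt0 p2_neq0 [p01 p01'] [p12 p12'] [p02 p02'].
have q_lt0 : complex.Im ((p2 - y * p0) * conjc (y * p2)) < 0.
  have : 0 < complex.Re p2 ^+ 2 + complex.Im p2 ^+ 2.
    rewrite lt0r paddr_eq0 ?sqr_ge0 // !sqrf_eq0 addr_ge0 ?sqr_ge0 // andbT.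
    by apply: contra p2_neq0; rewrite eq_complex.
  move: y_gt0 p02 {p2_neq0 p01 p01' p12 p12' p02'}.
  case: y p0 p1 p2 => [y1 y2] [a0 b0] [a1 b1] [a2 b2] /= y_gt0 p02 sq_gt0.
  have := mulr_gt0 sq_gt0 y_gt0.
  have := mulr_ge0 (addr_ge0 (sqr_ge0 y1) (sqr_ge0 y2))
    (_ : 0 <= - (a2 * - b0 + b2 * a0)).
  rewrite oppr_ge0 => /(_ p02).
  lra.
split; last split.
- by apply: contraTneq q_lt0 => ->; rewrite mul0r ltxx.
- split; last exact: ltW.
  move: p02'; case: y p0 p1 p2 {y_gt0 p2_neq0 p01 p01' p12 p12' p02 q_lt0}
    => [y1 y2] [a0 b0] [a1 b1] [a2 b2] /=.
  lra.
- move: p12 p01'; case: y p0 p1 p2 {y_gt0 p2_neq0 p01 p12' p02 p02' q_lt0}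
    => [y1 y2] [a0 b0] [a1 b1] [a2 b2] /=.
  lra.
- move: p12' p01; case: y p0 p1 p2 {y_gt0 p2_neq0 p01' p12 p02 p02' q_lt0}
    => [y1 y2] [a0 b0] [a1 b1] [a2 b2] /=.
  move=> p12' p01.
  have := mulr_ge0 (addr_ge0 (sqr_ge0 y1) (sqr_ge0 y2))
    (_ : 0 <= - (a1 * - b0 + b1 * a0)).
  rewrite oppr_ge0 => /(_ p01).
  lra.
Qed.

Lemma trinom_seq_upper_neq0 y j : 0 < complex.Im y -> trinom_seq y j != 0.
Proof.
move=> y_gt0.
have one_cone : in_cone y 1 1.
  rewrite /in_cone !(mulr1, mul1r) conjc1.
  by case: (y) y_gt0 => y1 y2 /= y2_gt0; split; rewrite ?lexx ?oppr_le0 ?ltW.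
suff inv : forall i, [/\ trinom_seq y i.+2 != 0,
    in_cone y (trinom_seq y i) (trinom_seq y i.+1),
    in_cone y (trinom_seq y i.+1) (trinom_seq y i.+2)
  & in_cone y (trinom_seq y i) (trinom_seq y i.+2)].
  by case: j => [|[|j]]; rewrite ?oner_neq0 //; have [] := inv j.
elim=> [|i [nz2 c01 c12 c02]]; first by split; rewrite // oner_neq0.
by have [] := in_cone_step y_gt0 nz2 c01 c12 c02; rewrite -trinom_seqS.
Qed.

Lemma trinom_seq_root_real y j : trinom_seq y j = 0 ->
  complex.Im y = 0 /\ 4%:R / 27%:R < complex.Re y.
Proof.
move=> y_root; have [Im_lt0|Im_gt0|Im0] := ltgtP (complex.Im y) 0.
- have := @trinom_seq_upper_neq0 (conjc y) j.
  rewrite trinom_seq_rmorph y_root rmorph0 eqxx.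
  by case: (y) Im_lt0 => y1 y2 /= y2_lt0; rewrite oppr_gt0 => /(_ y2_lt0).
- by have := trinom_seq_upper_neq0 j Im_gt0; rewrite y_root eqxx.
- split=> //; rewrite ltNge; apply/negP => /(trinom_seq_real_gt0 j).
  have y_real : y = (complex.Re y)%:C%C by case: (y) Im0 => ? ? /= ->.
  move: y_root; rewrite y_real trinom_seq_rmorph => -[->].
  by rewrite ltxx.
Qed.
End Cone.

(** * The edges of the chain of cycles *)

Section Graph.
Variable m : nat.

(** With [n = m + 3]: vertices of the descending path through the edges shared by
    consecutive cycles, the edge shared by cycles [k] and [k + 1] (numbered from
    1) going from [t_(k+1)] to [t_k].  Starting with
    [t_0 = 2] makes the first cycle look like all others: it descends from
    [t_2 = n] through [t_1 = 1] to [t_0 = 2] and climbs back. *)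
Definition hub (k : nat) : nat :=
  match k with 0 => 2 | 1 => 1 | k'.+2 => m.+3 + k' * m.+1 end.

Lemma hubS k : hub k.+3 = (hub k.+2 + m.+1)%N.
Proof. by rewrite /=; lia. Qed.

Lemma ltn_hub k l : (hub k.+2 < hub l.+2)%N = (k < l)%N.
Proof. by rewrite /= ltn_add2l ltn_mul2r. Qed.

Lemma nb_vertices_hub s : nb_vertices m.+3 s.+1 = hub s.+2.
Proof. rewrite /nb_vertices /=; lia. Qed.

(** The edges that cycle number [i + 2] adds to the previous cycles. *)
Definition block (i : nat) : rel nat := fun u v =>
  [|| single_edge (hub i.+1) (hub i.+2).+1 u v,
      path_edges (hub i.+2).+1 (hub i.+3).-1 u v
    | single_edge (hub i.+3) (hub i.+2) u v].

Lemma edges_blocks s u v :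
  edges m.+3 s.+1 u v = edges1 m.+3 u v || has (fun i => block i u v) (iota 0 s).
Proof.
case: s => [|s]; first by rewrite /= orbF.
rewrite /edges (_ : (s.+2 <= 1)%N = false) //.
rewrite (_ : s.+2 - 2 = s)%N; last lia.
rewrite [iota 0 _]/= [has _ (_ :: _)]/= orbA; congr (_ || _).
  rewrite /edges2; congr (_ || _).
  rewrite /block /=.
  by congr [|| single_edge _ _ _ _, path_edges _ _ _ _ | single_edge _ _ _ _]; lia.
apply: eq_in_has => i; rewrite mem_iota => /andP[i_gt0 _].
case: i i_gt0 => // i _; rewrite /edgesF /block /=.
by congr [|| single_edge _ _ _ _, path_edges _ _ _ _ | single_edge _ _ _ _]; nia.
Qed.

(** The vertices [u] whose only successor is [u + 1]; the first constructor
    covers [t_0] and the rest of the ascent to [t_2]. *)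
Variant interior s (u : nat) : Prop :=
| InteriorFirst of (2 <= u < hub 2)%N
| InteriorLater k of (k < s)%N & (hub k.+2 < u < hub k.+3)%N.

Lemma edgesP s u v : reflect
  [\/ interior s u /\ v = u.+1,
      exists2 k, (k <= s.+1)%N & u = hub k.+1 /\ v = hub k
    | exists2 k, (k < s)%N & u = hub k.+1 /\ v = (hub k.+2).+1]
  (edges m.+3 s.+1 u v).
Proof.
rewrite edges_blocks; apply: (iffP idP).
  case/orP => [/orP[/andP[u_bd /eqP->]|/andP[/eqP-> /eqP->]]|].
  - have [-> | u_neq1] := eqVneq u 1; first by constructor 2; exists 0.
    by constructor 1; split=> //; left; rewrite /=; lia.
  - by constructor 2; exists 1; rewrite //= addn0.
  case/hasP=> i; rewrite mem_iota add0n => /andP[_ i_lt].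
  case/or3P=> [/andP[/eqP-> /eqP->]|/andP[u_bd /eqP->]|/andP[/eqP-> /eqP->]].
  - by constructor 3; exists i.
  - by constructor 1; split=> //; right with i => //; move: u_bd; rewrite hubS; lia.
  - by constructor 2; exists i.+2.
case=> [[[u_bd|k k_lt u_bd] ->]|[k k_le [-> ->]]|[k k_lt [-> ->]]].
- by apply/orP; left; apply/orP; left; rewrite /path_edges eqxx; move: u_bd => /=; lia.
- apply/orP; right; apply/hasP; exists k; first by rewrite mem_iota.
  by apply/or3P; constructor 2; rewrite /path_edges eqxx; move: u_bd; rewrite hubS; lia.
- case: k k_le => [|[|k]] k_le.
  + by apply/orP; left; apply/orP; left; rewrite /path_edges /=; lia.
  + by apply/orP; left; apply/orP; right; rewrite /single_edge /= addn0 !eqxx.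
  + apply/orP; right; apply/hasP; exists k; first by rewrite mem_iota; lia.
    by apply/or3P; constructor 3; rewrite /single_edge !eqxx.
- apply/orP; right; apply/hasP; exists k; first by rewrite mem_iota.
  by apply/or3P; constructor 1; rewrite /single_edge !eqxx.
Qed.

Lemma hub_inj k l : hub k = hub l -> k = l.
Proof.
case: k l => [|[|k]] [|[|l]] //=; try lia.
by move/addnI/eqP; rewrite eqn_mul2r => /eqP->.
Qed.

Lemma interior_not_hub s k u : interior s u -> u <> hub k.+1.
Proof.
case=> [u_bd|j _ u_bd] u_hub; rewrite u_hub in u_bd.
  by case: k u_bd {u_hub} => [|k] //=; lia.
case: k u_bd {u_hub} => [|k]; first by rewrite /=; lia.
by rewrite !ltn_hub; lia.
Qed.

Lemma edges_interior s u v : interior s u -> edges m.+3 s.+1 u v = (v == u.+1).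
Proof.
move=> u_int; apply/edgesP/eqP => [[[] // | [k _ [u_hub _]] | [k _ [u_hub _]]] | ->].
- by case: (interior_not_hub u_int u_hub).
- by case: (interior_not_hub u_int u_hub).
- by constructor 1.
Qed.

(** For [k >= s] the vertex [t_(k+2) + 1] exceeds the last one, [t_(s+2)], so the
    bound on [v] turns the two kinds of hub, with and without an ascent, into
    one formula. *)
Lemma edges_hub s k v : (k <= s.+1)%N -> (v <= hub s.+2)%N ->
  edges m.+3 s.+1 (hub k.+1) v = (v == hub k) || (v == (hub k.+2).+1).
Proof.
move=> k_le v_le; apply/edgesP/orP.
  case=> [[u_int _]|[j _ [/hub_inj[<-] ->]]|[j _ [/hub_inj[<-] ->]]].
  - by case: (interior_not_hub u_int (erefl _)).
  - by left.
  - by right.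
case=> /eqP v_eq; first by constructor 2; exists k.
by constructor 3; exists k => //; rewrite -ltn_hub; lia.
Qed.

Lemma vertex_cases s u : (0 < u <= hub s.+2)%N ->
  interior s u \/ exists k, u = hub k.
Proof.
move=> u_bd; have [u_lt|u_ge] := ltnP u (hub 2).
  have [-> | u_neq1] := eqVneq u 1; first by right; exists 1.
  by left; left; lia.
pose q := ((u - m.+3) %/ m.+1)%N; pose d := ((u - m.+3) %% m.+1)%N.
have d_lt : (d < m.+1)%N by rewrite ltn_mod.
have u_eq : u = (m.+3 + (q * m.+1 + d))%N.
  by rewrite -divn_eq subnKC //; move: u_ge; rewrite /= addn0.
have [d0|d_neq0] := eqVneq d 0; first by right; exists q.+2; rewrite u_eq d0 addn0.
left; right with q; last by rewrite /=; lia.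
by rewrite -ltn_hub; apply: leq_trans (proj2 (andP u_bd)); rewrite /=; lia.
Qed.

End Graph.

(** * From eigenvectors to the recurrence *)

Lemma backward_trinom_seq (F : pzRingType) (y : F) (a : nat -> F) M :
    (forall k, (k < M)%N -> a k = a k.+1 - y * a k.+3) ->
    (forall k, (M < k)%N -> a k = 0) ->
  forall j, (j <= M)%N -> a (M - j)%N = trinom_seq y j * a M.
Proof.
move=> aS a0; elim/nat_ind3 => [|||j IH0 _ IH2] j_le.
- by rewrite subn0 mul1r.
- by rewrite aS ?(a0 (M - 1).+3) ?mulr0 ?subr0 ?mul1r; [congr a| |]; lia.
- rewrite aS ?(a0 (M - 2).+3) ?mulr0 ?subr0; [|lia|lia].
  rewrite (_ : (M - 2).+1 = M.-1); last lia.
  rewrite aS ?(a0 M.-1.+3) ?mulr0 ?subr0 ?mul1r; [congr a| |]; lia.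
rewrite aS; last lia.
rewrite (_ : (M - j.+3).+3 = M - j)%N; last lia.
rewrite (_ : (M - j.+3).+1 = M - j.+2)%N; last lia.
by rewrite IH0 ?IH2 ?trinom_seqS ?mulrBl ?mulrA //; lia.
Qed.

Lemma path_pow (F : comPzRingType) (l : F) (V : nat -> F) u d :
  (forall i, (i < d)%N -> l * V (u + i)%N = V (u + i).+1) ->
  l ^+ d * V u = V (u + d)%N.
Proof.
elim: d => [|d IH] VS; first by rewrite mul1r addn0.
by rewrite exprS -mulrA IH ?VS ?addnS // => i i_lt; apply: VS; apply: ltnW.
Qed.

(** Here [W k] is the value of an eigenvector at the hub [t_k] and [X k] its value
    at the first vertex of the ascent from [t_(k+1)] to [t_(k+3)]; [t_M] is the
    last hub.  The factor [l^k] turns the equations into the recurrence of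
    [trinom_seq] read downwards from [M], so that everything is a multiple of
    [W M]. *)
Lemma hub_recurrence_root (F : fieldType) (l : F) (m M : nat) (W X : nat -> F) :
    l != 0 -> (1 < M)%N ->
    (forall k, (k < M)%N -> l * W k.+1 = W k + X k) ->
    (forall k, (k < M)%N -> l ^+ m * X k = W k.+3) ->
    l ^+ m.+1 * W 0 = W 2 ->
    (forall k, (M < k)%N -> W k = 0) ->
  trinom_seq (l ^- m.+3) M.+1 * W M = 0 /\ (W M = 0 -> forall k, W k = 0).
Proof.
move=> l0 M_gt1 WX XW W02 W_out.
pose a k := l ^+ k * W k; pose y := l ^- m.+3.
have l_exp n : l ^+ n != 0 by rewrite expf_neq0.
have aS k : (k < M)%N -> a k = a k.+1 - y * a k.+3.
  move=> k_lt; rewrite /a -XW // (exprSr l k) -[_ * l * W _]mulrA (WX k k_lt).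
  rewrite [l ^+ k.+3 * _]mulrA -exprD (_ : k.+3 + m = m.+3 + k)%N; last lia.
  by rewrite exprD -mulrA mulKf // mulrDr addrK.
have a_out k : (M < k)%N -> a k = 0 by move=> /W_out W0; rewrite /a W0 mulr0.
have aE := backward_trinom_seq aS a_out.
split; last first.
  move=> WM0 k; have [/W_out // | k_le] := ltnP M k.
  apply/eqP; have := aE (M - k)%N (leq_subr _ _).
  by rewrite subKn // {2}/a WM0 !mulr0 => /eqP; rewrite mulf_eq0 (negPf (l_exp k)).
suff : trinom_seq y M.+1 * a M = 0.
  by rewrite /a mulrCA => /eqP; rewrite mulf_eq0 (negPf (l_exp M)) => /eqP.
have := aE M (leqnn M); have := aE (M - 2)%N (leq_subr _ _).
rewrite subnn subKn // => a2 a0.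
(* The three terms of [p_(M+1) a_M] become [a_0 - y a_2], zero by [W02]. *)
rewrite -(subnK M_gt1) addn2 trinom_seqS -addn2 subnK // mulrBl -a0 -mulrA -a2.
rewrite /a mul1r -W02 mulrA -exprD /y (_ : 2 + m.+1 = m.+3)%N // mulKf //.
by rewrite subrr.
Qed.

Section Eigenvector.
Variables (F : fieldType) (N : nat) (e : rel nat) (v : 'rV[F]_N).

(** The coordinate at the vertex numbered [j], and zero off the digraph: climbing
    beyond the last hub then contributes nothing, with no case distinction. *)
Definition vertex_val (j : nat) : F :=
  if j is i.+1 then oapp (v 0) 0 (insub i) else 0.

Lemma vertex_val_ord (i : 'I_N) : vertex_val i.+1 = v 0 i.
Proof. by rewrite /vertex_val valK. Qed.

Lemma vertex_val_out j : (N < j)%N -> vertex_val j = 0.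
Proof. by case: j => // j j_gt; rewrite /vertex_val insubF // ltnNge -ltnS j_gt. Qed.

Lemma eigen_eqn (l : F) u (s : seq nat) :
    v *m (\matrix_(i < N, j < N) (e i.+1 j.+1)%:R)^T = l *: v ->
    (0 < u <= N)%N -> uniq s -> 0 \notin s ->
    (forall w, (w <= N)%N -> e u w = (w \in s)) ->
  l * vertex_val u = \sum_(w <- s) vertex_val w.
Proof.
move=> v_eig u_bd s_uniq s_pos eE.
case: u u_bd eE => // u u_lt eE; pose i := Ordinal u_lt.
have /rowP/(_ i) := v_eig; rewrite !mxE => sumE.
rewrite (vertex_val_ord i) -sumE.
under eq_bigr => j _ do rewrite !mxE (eE j.+1) // mulr_natr mulrb -vertex_val_ord.
rewrite -big_mkcond /=.
rewrite -(big_mkord (fun j => j.+1 \in s) (fun j => vertex_val j.+1)).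
rewrite -big_filter -(big_map S predT vertex_val).
rewrite [RHS](bigID (fun w => w <= N)%N) /= [X in _ + X]big1_seq ?addr0; last first.
  by move=> w /andP[]; rewrite -ltnNge => w_gt _; exact: vertex_val_out.
rewrite -[RHS]big_filter; apply: perm_big; apply: uniq_perm.
- by rewrite (map_inj_uniq succn_inj) filter_uniq ?iota_uniq.
- exact: filter_uniq.
move=> [|w]; rewrite mem_filter.
  by rewrite (negPf s_pos) andbF; apply/mapP => -[].
rewrite (mem_map succn_inj) mem_filter mem_iota.
by rewrite andbC; congr (_ && _); lia.
Qed.
End Eigenvector.

Lemma char_poly_tr (A : comNzRingType) N (M : 'M[A]_N) :
  char_poly M^T = char_poly M.
Proof.
by rewrite /char_poly -det_tr /char_poly_mx linearB /= tr_scalar_mx map_trmx trmxK.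
Qed.

(** A right eigenvector of the adjacency matrix is taken, hence the transpose: its
    equation at a vertex sums over the successors, and a vertex that is not a hub
    has only one. *)
Lemma Phi_root_trinom_seq (F : fieldType) (n r : nat) (l : F) :
    (3 <= n)%N -> (1 <= r)%N -> l != 0 ->
    root (map_poly intr (Phi n r)) l ->
  trinom_seq (l ^- n) r.+2 = 0.
Proof.
case: n r => [|[|[|m]]] // [|s] // _ _ l0.
set N := nb_vertices m.+3 s.+1.
have N_hub : N = hub m s.+2 := nb_vertices_hub m s.
rewrite /Phi map_char_poly /= -char_poly_tr -eigenvalue_root_char.
case/eigenvalueP => v v_eig v_neq0.
have {}v_eig :
    v *m (\matrix_(i < N, j < N) (edges m.+3 s.+1 i.+1 j.+1)%:R)^T = l *: v.
  rewrite -v_eig; congr (v *m _^T); apply/matrixP => i j.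
  by rewrite !mxE rmorph_nat.
pose V := vertex_val v; pose W k := V (hub m k); pose X k := V (hub m k.+2).+1.
have hub_pos k : (0 < hub m k)%N by case: k => [|[|k]].
have V_int u : interior m s u -> l * V u = V u.+1.
  move=> u_int; rewrite [LHS](eigen_eqn (s := [:: u.+1]) v_eig) ?big_seq1 //.
    rewrite N_hub; case: u_int => [|k]; first by rewrite /=; lia.
    by move=> k_lt; move: (ltn_hub m k s); rewrite k_lt hubS; rewrite /=; nia.
  by move=> w _; rewrite inE edges_interior.
have V_out u : (hub m s.+2 < u)%N -> V u = 0.
  by rewrite -N_hub; exact: vertex_val_out.
have hub_out k : (s.+2 < k)%N -> (hub m s.+2 < hub m k)%N.
  by case: k => [|[|k]] // k_gt; rewrite ltn_hub.
have hub_in k : (k < s.+2)%N -> (hub m k.+1 <= hub m s.+2)%N.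
  by case: k => [|k] k_lt //; rewrite leqNgt ltn_hub -leqNgt; lia.
have WX k : (k < s.+2)%N -> l * W k.+1 = W k + X k.
  move=> k_lt; rewrite /W /X.
  rewrite [LHS](eigen_eqn (s := [:: hub m k; (hub m k.+2).+1]) v_eig).
  - by rewrite big_cons big_seq1.
  - by rewrite hub_pos N_hub hub_in.
  - by rewrite /= inE andbT; case: (k) => [|[|i]] /=; lia.
  - by rewrite !inE negb_or eq_sym -lt0n hub_pos.
  - by move=> w; rewrite N_hub => w_le; rewrite !inE edges_hub.
have XW k : l ^+ m * X k = W k.+3.
  have [k_lt|k_ge] := ltnP k s; last first.
    rewrite /X /W !V_out ?mulr0 //; first by rewrite hub_out //; lia.
    by rewrite ltnS leqNgt ltn_hub -leqNgt.
  rewrite /X path_pow; first by rewrite /W hubS addSnnS.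
  move=> i i_lt; apply: V_int; right with k => //.
  by rewrite hubS; lia.
have W02 : l ^+ m.+1 * W 0 = W 2.
  rewrite /W path_pow; first by rewrite /= addn0.
  by move=> i i_lt; apply: V_int; left; rewrite /=; lia.
have [] := hub_recurrence_root l0 (isT : 1 < s.+2)%N WX (fun k _ => XW k) W02.
  by move=> k k_gt; apply/V_out/hub_out.
move=> /eqP; rewrite mulf_eq0 => /orP[/eqP // | /eqP WM0] /(_ WM0) W0.
case/negP: v_neq0; apply/eqP/rowP => i; rewrite mxE -vertex_val_ord -/V.
(* An interior value is a multiple of the next one, so vanishing at the hubs
   spreads downwards from the last vertex. *)
have V0 d u : (0 < u)%N -> (u + d = N)%N -> V u = 0.
  elim: d u => [|d IH] u u_gt0 ud.
    by rewrite -[u]addn0 ud N_hub.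
  have [|u_int|[k ->]] := @vertex_cases m s u; [by rewrite -N_hub; lia| |exact: W0].
  have := V_int u u_int; rewrite (IH u.+1) ?addSnnS // => /eqP.
  by rewrite mulf_eq0 (negPf l0) => /eqP.
by apply: (V0 (N - i.+1)%N); rewrite // subnKC.
Qed.

Theorem theorem5p3 (R : realType) (n r : nat) (hn : (3 <= n)%N) (hr : (1 <= r)%N)
    (lambda : R[i]) (hroot : root (map_poly (intr : int -> R[i]) (Phi n r)) lambda)
    (hnz : lambda != 0) :
  complex.Im (lambda ^+ n) = 0 /\
  0 < complex.Re (lambda ^+ n) < 27%:R / 4%:R.
Proof.
have /trinom_seq_root_real := Phi_root_trinom_seq hn hr hnz hroot.
have : lambda ^+ n = (lambda ^- n)^-1 by rewrite invrK.
move: (lambda ^- n) => y -> [Im0 y_gt].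
have y_gt0 : 0 < complex.Re y by lra.
have -> : y^-1 = ((complex.Re y)^-1)%:C%C.
  by rewrite fmorphV; congr _^-1; case: y Im0 {y_gt y_gt0} => ? ? /= ->.
split=> //=; rewrite invr_gt0 y_gt0 -invf_div ltf_pV2 ?posrE //.
by rewrite divr_gt0 ?ltr0n.
Qed.
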